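(* Fix $\alpha>0$. Let $u_0:(0,1]\to[0,1]$ be a function that is continuous on $(0,1)$, and let $v_{0,-},v_{0,+}\in[0,1]$. For each positive integer $N$ write $\epsilon=1/N$ and consider the channel–reservoir process $(\omega_t)_{t\ge0}$ on $\Omega_N$ with generator $\mathbf L$ (defined in the context), with law $\mathbf P^{\epsilon}$ and expectation $\mathbf E^{\epsilon}$. Suppose that at the initial time $$\frac{n_{\pm}(0)}{M}\longrightarrow v_{0,\pm}\ \text{ in } \mathbf P^{\epsilon}\text{-probability as } N\to\infty,\qquad \mathbf E^{\epsilon}[\eta(x,0)]=u_0(\epsilon x)\quad\text{for all }x\in\Lambda_N .$$ Then for any $\alpha'\in[0,\alpha)$ and any $T>0$, $$\lim_{N\to\infty}\ \sup_{x\in\Lambda_N}\ \sup_{t\in[0,T]}\Big|\mathbf E^{\epsilon}\big[\eta(x,N^{2+\alpha'}t)\big]-\mathcal E^{\epsilon}\big[\eta(x,N^{2+\alpha'}t)\big]\Big|=0,$$ where $\mathcal E^{\epsilon}$ denotes expectation with respect to the simple symmetric exclusion process on $\{0,1\}^{\Lambda_N}$ with reservoirs of fixed densities $v_{0,\pm}$ at the boundaries (defined in the context), started from a distribution with $\mathcal E^{\epsilon}[\eta(x,0)]=u_0(\epsilon x)$ for all $x\in\Lambda_N$.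
   Context: Channel–reservoir process. For a positive integer $N$ let $\Lambda_N=\{1,\dots,N\}$ and let $M=\lfloor N^{1+\alpha}\rfloor$ be the size of each reservoir. The state space is $\Omega_N=\{0,1\}^{\Lambda_N}\times\{0,\dots,M\}\times\{0,\dots,M\}$, with elements $\omega=(\eta(1),\dots,\eta(N),n_-,n_+)$. The process is the continuous-time Markov chain with generator $$\mathbf Lf(\omega)=\tfrac12\sum_{x=1}^{N-1}[f(\omega^{x,x+1})-f(\omega)]+c_N(\omega)[f(\omega^N)-f(\omega)]+c_1(\omega)[f(\omega^1)-f(\omega)],$$ where $\omega^{x,x+1}$ is obtained from $\omega$ by exchanging $\eta(x)$ and $\eta(x+1)$; $c_N(\omega)=\tfrac12(1-\tfrac{n_+}{M})\eta(N)+\tfrac12\tfrac{n_+}{M}(1-\eta(N))$, and $\omega^N$ is obtained from $\omega$ by replacing $(\eta(N),n_+)$ by $(0,n_++1)$ if $\eta(N)=1$ and by $(1,n_+-1)$ if $\eta(N)=0$; $c_1(\omega)=\tfrac12(1-\tfrac{n_-}{M})\eta(1)+\tfrac12\tfrac{n_-}{M}(1-\eta(1))$, and $\omega^1$ is obtained by replacing $(\eta(1),n_-)$ by $(0,n_-+1)$ if $\eta(1)=1$ and by $(1,n_--1)$ if $\eta(1)=0$. The values at time $t$ are $\eta(x,t)$, $n_\pm(t)$. The initial distribution may depend on $N$. Exclusion process with fixed reservoirs of densities $v_{0,\pm}$. This is the continuous-time Markov chain on $\{0,1\}^{\Lambda_N}$ in which the contents of each pair of neighbouring sites $x,x+1$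 ($1\le x\le N-1$) are exchanged at rate $\tfrac12$; at site $1$ a particle is created (if $\eta(1)=0$) at rate $\tfrac12v_{0,-}$ and removed (if $\eta(1)=1$) at rate $\tfrac12(1-v_{0,-})$; and at site $N$ a particle is created (if $\eta(N)=0$) at rate $\tfrac12v_{0,+}$ and removed (if $\eta(N)=1$) at rate $\tfrac12(1-v_{0,+})$. *)

(* Defs.v *)
From HB Require Import structures.
From mathcomp Require Import all_boot all_order all_algebra all_fingroup.
From mathcomp Require Import all_classical all_reals all_analysis.

Set Implicit Arguments.
Unset Strict Implicit.
Unset Printing Implicit Defensive.

Import Order.TTheory GRing.Theory Num.Theory.
Import numFieldNormedType.Exports.

Local Open Scope classical_set_scope.
Local Open Scope ring_scope.

Section MarkovChain.
Context {R : realType} {S : finType}.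

(* A generator is an operator L on functions S -> R.  As S is finite, its
   semigroup is e^{tL} f = \sum_k t^k / k! L^k f. *)
Definition semigroup (L : (S -> R) -> S -> R) (t : R) (f : S -> R) (s : S) : R :=
  limn (series (fun k => t ^+ k / k`!%:R * iter k L f s)).

Definition transition_prob (L : (S -> R) -> S -> R) (t : R) (s s' : S) : R :=
  semigroup L t (fun z => (z == s')%:R) s.

(* The Markov property
     P(X_{t_0} = s_0, ..., X_{t_{k+1}} = s_{k+1})
       = P(X_{t_0} = s_0, ..., X_{t_k} = s_k) p_{t_{k+1} - t_k}(s_k, s_{k+1})
   for 0 <= t_0 <= t_1 <= ...; the law of X_0 is arbitrary.  Only the times
   t >= 0 of the family X matter. *)
Definition is_markov_chain (L : (S -> R) -> S -> R)
    (d : measure_display) (T : measurableType d) (P : probability T R)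
    (X : R -> T -> S) : Prop :=
  (forall (t : R) (s : S), 0 <= t -> measurable [set w | X t w = s]) /\
  (forall (t : nat -> R) (s : nat -> S) (k : nat),
     0 <= t 0%N -> {homo t : i j / (i <= j)%N >-> i <= j} ->
     P (\bigcap_(i < k.+2) [set w | X (t i) w = s i]) =
     (P (\bigcap_(i < k.+1) [set w | X (t i) w = s i]) *
      (transition_prob L (t k.+1 - t k) (s k) (s k.+1))%:E)%E).

End MarkovChain.

(* The channel has N = n.+1 sites, so N ranges over the positive integers; the
   site x of {1, ..., N} is the ordinal x - 1, hence site 1 is ord0 and site N
   is ord_max. *)
Definition config (n : nat) := {ffun 'I_n.+1 -> bool}.

Definition exchange n (x y : 'I_n.+1) (eta : config n) : config n :=
  [ffun z => eta (tperm x y z)].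

Definition flip n (x : 'I_n.+1) (eta : config n) : config n :=
  [ffun z => if z == x then ~~ eta z else eta z].

Definition reservoir_size (R : realType) (alpha : R) (n : nat) : nat :=
  Num.truncn (n.+1%:R `^ (1 + alpha)).

Section ChannelReservoir.
Context {R : realType} (n M : nat).

(* (eta, n_-, n_+) *)
Definition cr_state := (config n * 'I_M.+1 * 'I_M.+1)%type.

Definition occ (w : cr_state) : config n := w.1.1.
Definition n_minus (w : cr_state) : 'I_M.+1 := w.1.2.
Definition n_plus (w : cr_state) : 'I_M.+1 := w.2.

Definition exchange_rate (b : bool) (m : 'I_M.+1) : R :=
  2^-1 * (1 - m%:R / M%:R) * b%:R + 2^-1 * (m%:R / M%:R) * (1 - b%:R).

Definition c_right (w : cr_state) : R := exchange_rate (occ w ord_max) (n_plus w).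
Definition c_left (w : cr_state) : R := exchange_rate (occ w ord0) (n_minus w).

(* The values m + 1 with m = M and m - 1 with m = 0, which leave {0, ..., M},
   are only reached with exchange_rate b m = 0. *)
Definition reservoir_update (b : bool) (m : 'I_M.+1) : 'I_M.+1 :=
  if b then inord m.+1 else inord m.-1.

Definition move_bond (x : 'I_n) (w : cr_state) : cr_state :=
  (exchange (inord x) (inord x.+1) (occ w), n_minus w, n_plus w).

Definition move_right (w : cr_state) : cr_state :=
  (flip ord_max (occ w), n_minus w, reservoir_update (occ w ord_max) (n_plus w)).

Definition move_left (w : cr_state) : cr_state :=
  (flip ord0 (occ w), reservoir_update (occ w ord0) (n_minus w), n_plus w).

Definition cr_generator (f : cr_state -> R) (w : cr_state) : R :=
  2^-1 * (\sum_(x < n) (f (move_bond x w) - f w))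
  + c_right w * (f (move_right w) - f w)
  + c_left w * (f (move_left w) - f w).

End ChannelReservoir.

Section FixedReservoirs.
Context {R : realType} (n : nat) (vminus vplus : R).

Definition creation_removal_rate (v : R) (b : bool) : R :=
  if b then 2^-1 * (1 - v) else 2^-1 * v.

Definition ssep_generator (f : config n -> R) (eta : config n) : R :=
  2^-1 * (\sum_(x < n) (f (exchange (inord x) (inord x.+1) eta) - f eta))
  + creation_removal_rate vminus (eta ord0) * (f (flip ord0 eta) - f eta)
  + creation_removal_rate vplus (eta ord_max) * (f (flip ord_max eta) - f eta).

End FixedReservoirs.

(* Convergence in probability to a constant of random variables that may live
   on different probability spaces. *)
Definition cvg_in_prob (R : realType) (d : nat -> measure_display)
    (T : forall n, measurableType (d n)) (P : forall n, probability (T n) R)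
    (Z : forall n, T n -> R) (c : R) : Prop :=
  forall delta : R, 0 < delta ->
    (fun n => P n [set w | delta < `|Z n w - c|]) @ \oo --> 0%E.

Definition mean_occ (R : realType) (d : measure_display) (T : measurableType d)
    (P : probability T R) (n : nat) (Z : T -> config n) (x : 'I_n.+1) : \bar R :=
  expectation P (fun w => (Z w x)%:R : R).

(* Main.v *)
Require Import Defs.
From HB Require Import structures.
From mathcomp Require Import all_boot all_order all_algebra all_fingroup.
From mathcomp Require Import all_classical all_reals all_analysis.
From mathcomp Require Import zify ring lra.

Set Implicit Arguments.
Unset Strict Implicit.
Unset Printing Implicit Defensive.

Import Order.TTheory GRing.Theory Num.Theory.
Import numFieldNormedType.Exports.

Local Open Scope classical_set_scope.
Local Open Scope ring_scope.

(** Write N = n + 1 for the number of sites and v_-(t), v_+(t) for the mean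
    densities n_-/M, n_+/M of the reservoirs.  Although both processes are
    interacting particle systems, their generators send each occupation
    variable to a linear combination of occupation variables and reservoir
    densities.  The mean profile of either process, completed by ghost sites 0
    and N + 1 which carry the densities of the reservoirs, thus solves the
    discrete heat equation p_k' = (p_{k-1} + p_{k+1}) / 2 - p_k for
    1 <= k <= N ([flow_heat]).

    The difference of the two mean profiles solves the same equation, vanishes
    at time 0, and equals v_-(t) - v_{0,-} and v_+(t) - v_{0,+} at the ghost
    sites.  By the maximum principle ([heat_maximum_norm]) it is bounded by the
    largest displacement of the two reservoirs, so that it is enough to show
    that the reservoirs hardly move up to time s = N^(2 + alpha') T.

    The particle current into a reservoir has the order 1/N of a gradient
    after a time of order N^2, whereas the trivial bound 1/2 on this current
    only controls the density of the reservoir when alpha > 1 + alpha'.  The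
    gain is obtained by testing the profile
    against the harmonic function h(k) = k / (N + 1): the quantity
    G = M v_+ + \sum_k h(k) p_k has derivative (v_- - v_+) / (2 (N + 1)), because
    h is harmonic, vanishes at 0 and equals 1 at N + 1.  As 0 <= \sum_k h(k) p_k
    <= N, this gives |v_+(s) - v_+(0)| <= (N + s / (2 (N + 1))) / M
    ([reservoir_drift_right]); reflection treats v_-.  With M of order
    N^(1 + alpha) the bound is of order N^(- alpha) + T N^(alpha' - alpha), and
    tends to 0 since alpha' < alpha ([drift_bound]).  Convergence in probability
    of the initial densities gives convergence of their means, the densities
    being bounded ([mean_cvg_in_prob]).

    The link with the processes is the identity E f(X_t) = \sum_s P(X_0 = s)
    (e^{tL} f)(s) ([markov_mean]), whose right-hand side is an everywhere
    convergent power series in t that can be differentiated term by term. *)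

(** * Discrete heat equation and slow reservoirs *)

Section OrdinaryDifferential.
Context {R : realType}.

Lemma increment_le (f df : R -> R) (S C : R) : 0 <= S ->
  (forall t : R, 0 <= t <= S -> is_derive t 1 f (df t)) ->
  (forall t : R, 0 <= t <= S -> df t <= C) ->
  f S - f 0 <= C * S.
Proof.
move=> S0 fdf dfC.
have [t /[!in_itv]/= tS ->] : exists2 c, c \in `[0, S]%R &
    f S - f 0 = df c * (S - 0).
  apply: MVT_segment => //.
    by move=> t /[!in_itv]/= /andP[t0 tS]; apply: fdf; rewrite !ltW.
  apply: derivable_within_continuous => t /[!in_itv]/= tS.
  by have := fdf _ tS => ?.
by rewrite subr0 ler_wpM2r// dfC.
Qed.

(** The ghost sites 0 and N + 1 are left free, so that the same equation covers
    fixed reservoirs, evolving reservoirs and the difference of both. *)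
Definition heat_flow (N : nat) (w : nat -> R -> R) :=
  forall k, (k < N)%N -> forall t : R,
    is_derive t 1 (w k.+1) (2^-1 * (w k t + w k.+2 t) - w k.+1 t).

Lemma heat_flowB N w w' :
  heat_flow N w -> heat_flow N w' -> heat_flow N (fun k => w k - w' k).
Proof.
move=> hw hw' k kN t.
have dw := hw k kN t; have dw' := hw' k kN t.
by apply: is_derive_eq; rewrite !fctE; ring.
Qed.

(** One step of a bootstrap: (e^t w)' = e^t (w_{k-1} + w_{k+1}) / 2 is at most
    e^t A when A bounds w everywhere, and integrating from w <= delta at time 0
    improves the bound A inside by a fixed fraction of A - delta.  Working with
    increments avoids differentiating at a point where a maximum is attained,
    which could be the end of the time interval. *)
Lemma heat_contraction N w (S A delta : R) : heat_flow N w ->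
  delta <= A ->
  (forall k, (k < N)%N -> w k.+1 0 <= delta) ->
  (forall k (t : R), (k <= N.+1)%N -> 0 <= t <= S -> w k t <= A) ->
  forall k (t : R), (k < N)%N -> 0 <= t <= S ->
    w k.+1 t <= A - (A - delta) * expR (- S).
Proof.
move=> hw dA w0 wA k t kN /andP[t0 tS].
have dw (u : R) : is_derive u 1 (fun u => expR u * (w k.+1 u - A))
    (expR u * (2^-1 * (w k u + w k.+2 u) - A)).
  have dw := hw k kN u.
  apply: is_derive_eq; rewrite /GRing.scale/=; ring.
have := @increment_le _ _ t 0 t0 (fun u _ => dw u).
rewrite mul0r expR0 mul1r subr_le0 => /(_ _)/wrap[].
  move=> u /andP[u0 ut]; rewrite mulr_ge0_le0 ?expR_ge0//.
  have uS : 0 <= u <= S by rewrite u0 (le_trans ut).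
  have := wA k u (leqW (ltnW kN)) uS; have := wA k.+2 u kN uS.
  lra.
move=> /(le_trans)/(_ (lerB (w0 _ kN) (lexx A))) H.
have {}H : w k.+1 t - A <= expR (- t) * (delta - A).
  by rewrite -(ler_pM2l (expR_gt0 t)) mulrA expRxMexpNx_1 mul1r.
have : expR (- S) <= expR (- t) by rewrite ler_expR lerN2.
have : 0 <= A - delta by rewrite subr_ge0.
by move: H => + + /ler_wpM2l => + /[swap] /[apply]; lra.
Qed.

(** The supremum of w over the interior cannot exceed delta, since
    [heat_contraction] applied to that supremum would strictly improve it. *)
Lemma heat_maximum N w (S delta B : R) : 0 <= S -> heat_flow N w ->
  (forall k (t : R), (k <= N.+1)%N -> 0 <= t <= S -> w k t <= B) ->
  (forall k, (k < N)%N -> w k.+1 0 <= delta) ->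
  (forall t : R, 0 <= t <= S -> w 0%N t <= delta /\ w N.+1 t <= delta) ->
  forall k (t : R), (k < N)%N -> 0 <= t <= S -> w k.+1 t <= delta.
Proof.
move=> S0 hw wB w0 wb k0 t0 k0N t0S.
pose E := [set w k.+1 t | k in `I_N & t in [set t | 0 <= t <= S]].
have E0 : E (w k0.+1 t0) by exists k0 => //; exists t0.
have supE : has_sup E.
  split; first by exists (w k0.+1 t0).
  by exists B => _ [k /= kN [t tS <-]]; apply: wB => //; rewrite leqW.
have wsup k t : (k < N)%N -> 0 <= t <= S -> w k.+1 t <= sup E.
  by move=> kN tS; apply: ub_le_sup; [case: supE|exists k => //; exists t].
apply: (le_trans (wsup _ _ k0N t0S)); rewrite leNgt; apply/negP => dE.
have gap : 0 < (sup E - delta) * expR (- S).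
  by rewrite mulr_gt0 ?subr_gt0 ?expR_gt0.
suff : sup E <= sup E - (sup E - delta) * expR (- S) by lra.
apply: ge_sup; first by exists (w k0.+1 t0).
move=> _ [k /= kN [t tS <-]].
apply: (heat_contraction hw (ltW dE)) => // -[|j] u jN uS.
  by rewrite (le_trans (wb _ uS).1)// ltW.
move: jN; rewrite ltnS leq_eqVlt => /predU1P[->|jN]; last exact: wsup.
by rewrite (le_trans (wb _ uS).2)// ltW.
Qed.

Lemma heat_maximum_norm N w (S delta B : R) : 0 <= S -> heat_flow N w ->
  (forall k (t : R), (k <= N.+1)%N -> 0 <= t <= S -> `|w k t| <= B) ->
  (forall k, (k < N)%N -> `|w k.+1 0| <= delta) ->
  (forall t : R, 0 <= t <= S -> `|w 0%N t| <= delta /\ `|w N.+1 t| <= delta) ->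
  forall k (t : R), (k < N)%N -> 0 <= t <= S -> `|w k.+1 t| <= delta.
Proof.
move=> S0 hw wB w0 wb k t kN tS.
rewrite ler_norml lerNl; apply/andP; split; last first.
  apply: (@heat_maximum N w S delta B) => //.
  - by move=> *; rewrite (le_trans (ler_norm _))// wB.
  - by move=> *; rewrite (le_trans (ler_norm _))// w0.
  - by move=> u /wb[wl wr]; split; rewrite (le_trans (ler_norm _)).
apply: (@heat_maximum N (fun k => - w k) S delta B) => //.
- move=> j jN u; have ? := hw j jN u; apply: is_derive_eq.
  by rewrite !fctE; ring.
- by move=> *; rewrite (le_trans (ler_norm _))// normrN wB.
- by move=> *; rewrite (le_trans (ler_norm _))// normrN w0.
- by move=> u /wb[wl wr]; split; rewrite (le_trans (ler_norm _))// normrN.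
Qed.

(** Summation by parts against k, which is harmonic and vanishes at 0: only
    boundary terms survive. *)
Lemma sum_weighted_laplacian (p : nat -> R) N :
  \sum_(k < N) k.+1%:R * (2^-1 * (p k + p k.+2) - p k.+1) =
  2^-1 * (p 0%N + N%:R * p N.+1 - N.+1%:R * p N).
Proof.
elim: N => [|N IH]; first by rewrite big_ord0; ring.
rewrite big_ord_recr/= IH -![N.+2%:R]natr1 -![N.+1%:R]natr1; by field.
Qed.

(** Mean profile of a channel joined to two reservoirs of size m, seen as ghost
    sites 0 and N + 1; a reservoir is a site slowed down by the factor m. *)
Definition reservoir_flow (N : nat) (m : R) (p : nat -> R -> R) :=
  [/\ heat_flow N p,
      forall t : R, is_derive t 1 (p N.+1) ((2 * m)^-1 * (p N t - p N.+1 t)) &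
      forall t : R, is_derive t 1 (p 0%N) ((2 * m)^-1 * (p 1%N t - p 0%N t))].

Lemma reservoir_flow_rev N m p : reservoir_flow N m p ->
  reservoir_flow N m (fun k => p (N.+1 - k)%N).
Proof.
move=> [hp hR hL]; split => [k kN t|t|t].
- have -> : (N.+1 - k.+1 = (N - k.+1).+1)%N by lia.
  have -> : (N.+1 - k = (N - k.+1).+2)%N by lia.
  have -> : (N.+1 - k.+2 = N - k.+1)%N by lia.
  by rewrite [X in _ * X]addrC; apply: hp; lia.
- by rewrite subnn subSnn.
- by rewrite subn0 subn1.
Qed.

(** G below is the content of the right reservoir plus that of the channel
    weighted by the probability k / (N + 1) that a symmetric walk from k exits
    on the right.  Its derivative is only (p_0 - p_{N+1}) / (2 (N + 1)), and it
    differs from m p_{N+1} by at most N. *)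
Lemma reservoir_drift_right N (m S : R) p : 0 < m -> 0 <= S ->
  reservoir_flow N m p ->
  (forall k (t : R), (k <= N.+1)%N -> 0 <= t <= S -> 0 <= p k t <= 1) ->
  `|p N.+1 S - p N.+1 0| <= (N%:R + S / (2 * N.+1%:R)) / m.
Proof.
move=> m0 S0 [hp hR _] p01.
pose G t := m * p N.+1 t + N.+1%:R^-1 * \sum_(k < N) k.+1%:R * p k.+1 t.
have dG (t : R) : is_derive t 1 G ((2 * N.+1%:R)^-1 * (p 0%N t - p N.+1 t)).
  have dsum : is_derive t 1 (fun t => \sum_(k < N) k.+1%:R * p k.+1 t)
      (\sum_(k < N) k.+1%:R * (2^-1 * (p k t + p k.+2 t) - p k.+1 t)).
    have -> : (fun t => \sum_(k < N) k.+1%:R * p k.+1 t) =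
        \sum_(k < N) (k.+1%:R *: p k.+1).
      by apply/funext => u; rewrite fct_sumE.
    apply: is_derive_sum => k; have ? := hp k (ltn_ord k) t.
    exact: is_derive_eq.
  have ? := hR t.
  apply: is_derive_eq.
  rewrite (sum_weighted_laplacian (p ^~ t)) /GRing.scale/=.
  have -> : (N.+1%:R : R) = 1 + N%:R by rewrite -natr1 addrC.
  field; rewrite gt_eqF//= gt_eqF// ltr_wpDr//; exact: ler0n.
have GS : `|G S - G 0| <= S / (2 * N.+1%:R).
  have c0 : 0 <= (2 * N.+1%:R)^-1 :> R by rewrite invr_ge0 mulr_ge0.
  have pb t : 0 <= t <= S -> -1 <= p 0%N t - p N.+1 t <= 1.
    move=> tS; have := p01 0%N t isT tS; have := p01 N.+1 t (leqnn _) tS; lra.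
  rewrite ler_norml lerNl mulrC; apply/andP; split; last first.
    apply: (increment_le S0 (fun t _ => dG t)) => t /pb/andP[_ h].
    by rewrite -[leRHS]mulr1 ler_wpM2l.
  have dNG (t : R) : is_derive t 1 (- G) (- ((2 * N.+1%:R)^-1 * (p 0%N t - p N.+1 t))).
    exact: is_derive_eq.
  have -> : - (G S - G 0) = (- G) S - (- G) 0 by rewrite !fctE opprD.
  apply: (increment_le S0 (fun t _ => dNG t)) => t /pb/andP[h _].
  by rewrite -mulrN -[leRHS]mulr1 ler_wpM2l// lerNl.
have sumb t : 0 <= t <= S ->
    0 <= N.+1%:R^-1 * (\sum_(k < N) k.+1%:R * p k.+1 t) <= N%:R.
  move=> tS; rewrite mulrC ler_pdivrMr// pmulr_lge0 ?invr_gt0//.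
  apply/andP; split.
    apply: sumr_ge0 => k _; rewrite mulr_ge0//.
    by case/andP: (p01 k.+1 t (leqW (ltn_ord k)) tS).
  apply: (@le_trans _ _ (\sum_(k < N) N.+1%:R)); last first.
    by rewrite sumr_const card_ord mulr_natl.
  apply: ler_sum => k _; rewrite -[leRHS]mulr1 ler_pM//.
  - by case/andP: (p01 k.+1 t (leqW (ltn_ord k)) tS).
  - by rewrite ler_nat ltnW // ltnS.
  - by case/andP: (p01 k.+1 t (leqW (ltn_ord k)) tS).
have dist_le (a b c : R) : 0 <= a <= c -> 0 <= b <= c -> `|a - b| <= c.
  by rewrite ler_distl; lra.
have s0 : 0 <= N.+1%:R^-1 * (\sum_(k < N) k.+1%:R * p k.+1 0) <= N%:R.
  by apply: sumb; rewrite lexx.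
have s1 : 0 <= N.+1%:R^-1 * (\sum_(k < N) k.+1%:R * p k.+1 S) <= N%:R.
  by apply: sumb; rewrite S0 lexx.
rewrite ler_pdivlMr// -[X in _ * X](gtr0_norm m0) -normrM.
have -> : (p N.+1 S - p N.+1 0) * m = (G S - G 0) -
  (N.+1%:R^-1 * (\sum_(k < N) k.+1%:R * p k.+1 S) -
   N.+1%:R^-1 * (\sum_(k < N) k.+1%:R * p k.+1 0)) by rewrite /G; ring.
rewrite (le_trans (ler_normB _ _))// addrC lerD//.
exact: dist_le.
Qed.

Lemma reservoir_drift N (m S : R) p : 0 < m -> 0 <= S ->
  reservoir_flow N m p ->
  (forall k (t : R), (k <= N.+1)%N -> 0 <= t <= S -> 0 <= p k t <= 1) ->
  forall k, k = 0%N \/ k = N.+1 ->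
  `|p k S - p k 0| <= (N%:R + S / (2 * N.+1%:R)) / m.
Proof.
move=> m0 S0 hp p01 k [->|->]; last exact: reservoir_drift_right.
have := @reservoir_drift_right _ _ _ _ m0 S0 (reservoir_flow_rev hp).
rewrite subnn; apply => k' t k'N tS; apply: p01 => //; exact: leq_subr.
Qed.

End OrdinaryDifferential.

(** * Semigroup of a linear operator on a finite set *)

Section Semigroup.
Context {R : realType} {S : finType}.
Variable L : (S -> R) -> S -> R.
Hypothesis linL : linear L.

(** Matrix form of L, which reduces the norm bound and the expansion of the
    semigroup to finite sums. *)
Lemma linear_expand f s : L f s = \sum_z f z * L (fun y => (y == z)%:R) s.
Proof.
pose lL : {linear (S -> R) -> (S -> R)} := HB.pack L
  (GRing.isLinear.Build R (S -> R) (S -> R) _ L linL).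
have fE : f = \sum_z f z *: (fun y => (y == z)%:R) :> (S -> R).
  apply/funext => y; rewrite fct_sumE (bigD1 y)//= big1 => [|z zy].
    by rewrite !fctE eqxx addr0 /GRing.scale/= mulr1.
  by rewrite !fctE eq_sym (negbTE zy) /GRing.scale/= mulr0.
have -> : L f = lL f by [].
rewrite {1}fE linear_sum fct_sumE; apply: eq_bigr => z _.
by rewrite linearZ.
Qed.

(** Any geometric bound is enough for convergence of the exponential series, so
    the constants are the sums of all entries of L and of f. *)
Lemma iter_linear_le f : exists C B : R, [/\ 0 <= C, 0 <= B &
  forall k s, `|iter k L f s| <= C ^+ k * B].
Proof.
exists (\sum_s \sum_z `|L (fun y => (y == z)%:R) s|), (\sum_s `|f s|).
split; [by do 2 apply: sumr_ge0 => ? _|exact: sumr_ge0|move=> k s].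
set C := \sum_s _.
apply: (@le_trans _ _ (\sum_s `|iter k L f s|)).
  by rewrite (bigD1 s)//= lerDl sumr_ge0.
elim: k => [|k IH]; first by rewrite expr0 mul1r.
rewrite exprS -mulrA /= (le_trans _ (ler_wpM2l _ IH))//; last first.
  by do 2 apply: sumr_ge0 => ? _.
rewrite /C mulr_suml; apply: ler_sum => y _.
rewrite linear_expand (le_trans (ler_norm_sum _ _ _))// mulr_suml.
apply: ler_sum => z _; rewrite normrM mulrC ler_wpM2l//.
by rewrite (bigD1 z)//= lerDl sumr_ge0.
Qed.

Definition taylor_coef f s : R^nat := fun k => iter k L f s / k`!%:R.

Lemma semigroupE t f s : semigroup L t f s = limn (pseries (taylor_coef f s) t).
Proof.
rewrite /semigroup /pseries; congr (limn (series _)).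
by apply/funext => k; rewrite /taylor_coef/= mulrC mulrAC mulrA.
Qed.

Lemma is_cvg_taylor f s t : cvgn (pseries (taylor_coef f s) t).
Proof.
have [C [B [C0 B0 LB]]] := iter_linear_le f.
apply: normed_cvg.
apply: (@series_le_cvg _ _ (B *: exp_coeff (C * `|t|))) => [k|k|k|].
- exact: normr_ge0.
- by rewrite !fctE /GRing.scale/= mulr_ge0// exp_coeff_ge0// mulr_ge0.
- rewrite !fctE /GRing.scale/= /exp_coeff /taylor_coef/=.
  rewrite !normrM normfV normr_nat normrX exprMn.
  rewrite [leLHS](_ : _ = `|iter k L f s| * (`|t| ^+ k / k`!%:R)); last by ring.
  rewrite [leRHS](_ : _ = C ^+ k * B * (`|t| ^+ k / k`!%:R)); last by ring.
  by rewrite ler_wpM2r// divr_ge0// exprn_ge0.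
- by apply: is_cvg_seriesZ; exact: is_cvg_series_exp_coeff.
Qed.

(** Formal derivation of e^{tL} f is the passage from f to L f. *)
Lemma taylor_coef_diffs f s :
  pseries_diffs (taylor_coef f s) = taylor_coef (L f) s.
Proof.
apply/funext => k; rewrite /pseries_diffs /taylor_coef -iterSr factS natrM.
by field; rewrite nat1r !pnatr_eq0 -lt0n fact_gt0.
Qed.

Lemma is_derive_semigroup f s (t : R) :
  is_derive t 1 (fun t => semigroup L t f s) (semigroup L t (L f) s).
Proof.
rewrite semigroupE -taylor_coef_diffs.
under eq_fun do rewrite semigroupE.
apply: (@pseries_snd_diffs _ _ (`|t| + 1)).
- exact: is_cvg_taylor.
- by rewrite taylor_coef_diffs; exact: is_cvg_taylor.
- by rewrite !taylor_coef_diffs; exact: is_cvg_taylor.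
- by rewrite [ltRHS]ger0_norm ?ltrDl// addr_ge0.
Qed.

(** The Markov property speaks of transition probabilities only; this recovers
    the action of the semigroup on all functions. *)
Lemma semigroup_expand t f s :
  semigroup L t f s = \sum_z f z * transition_prob L t s z.
Proof.
rewrite semigroupE; apply/cvg_lim => //.
have iterE k : iter k L f s = \sum_z f z * iter k L (fun y => (y == z)%:R) s.
  elim: k s => [|k IH] s /=.
    rewrite (bigD1 s)//= big1 => [|z zs]; first by rewrite eqxx mulr1 addr0.
    by rewrite eq_sym (negbTE zs) mulr0.
  rewrite linear_expand.
  under [LHS]eq_bigr do rewrite IH mulr_suml.
  rewrite exchange_big/=; apply: eq_bigr => z _.
  rewrite [in RHS]linear_expand mulr_sumr.
  by apply: eq_bigr => y _; rewrite mulrA.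
have -> : pseries (taylor_coef f s) t =
    (fun m => \sum_z f z * pseries (taylor_coef (fun y => (y == z)%:R) s) t m).
  apply/funext => m; rewrite /pseries/series/=.
  under [in RHS]eq_bigr do rewrite mulr_sumr.
  rewrite exchange_big/=; apply: eq_bigr => k _.
  rewrite /taylor_coef iterE !mulr_suml; apply: eq_bigr => z _.
  by rewrite !mulrA.
apply: (cvg_big (op := +%R)) => [|z _]; first exact: add_continuous.
by apply: cvgMl_tmp; rewrite /transition_prob semigroupE; exact: is_cvg_taylor.
Qed.

End Semigroup.

(** * Finite-valued random variables *)

Section Law.
Context {R : realType} {S : finType}.

Definition law d (T : measurableType d) (P : probability T R) (Z : T -> S) (s : S) : R :=
  fine (P [set w | Z w = s]).

Definition mean (mu : S -> R) (f : S -> R) : R := \sum_s mu s * f s.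

Lemma measure_finType_bigcup d (T : measurableType d) (P : probability T R)
    (F : S -> set T) (A : pred S) :
  (forall s, measurable (F s)) -> trivIset [set` A] F ->
  P (\bigcup_(s in [set` A]) F s) = (\sum_(s | A s) P (F s))%E.
Proof.
move=> mF tF; rewrite measure_fin_bigcup//.
rewrite -(@bigfs _ _ _ _ (index_enum S))//; first exact: index_enum_uniq.
by move=> s _; rewrite mem_index_enum.
Qed.

Context d (T : measurableType d) (P : probability T R) (Z : T -> S).
Hypothesis mZ : forall s, measurable [set w | Z w = s].

Lemma law_ge0 s : 0 <= law P Z s.
Proof. by rewrite fine_ge0. Qed.

Lemma lawE s : P [set w | Z w = s] = (law P Z s)%:E.
Proof. by rewrite fineK// fin_num_measure. Qed.

Lemma measurable_finpre (A : set S) : measurable [set w | A (Z w)].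
Proof.
rewrite (_ : [set w | A (Z w)] = \bigcup_(s in A) [set w | Z w = s]).
  by apply: fin_bigcup_measurable => //; exact: finite_finset.
by apply/seteqP; split => w /= => [?|[s As ->]//]; exists (Z w).
Qed.

Lemma prob_preimage (A : pred S) :
  P [set w | A (Z w)] = (mean (law P Z) (fun s => (A s)%:R))%:E.
Proof.
rewrite (_ : [set w | A (Z w)] = \bigcup_(s in [set` A]) [set w | Z w = s]); last first.
  by apply/seteqP; split => w /= => [?|[s As ->]//]; exists (Z w).
rewrite measure_finType_bigcup//; last by move=> s s' _ _ [w [/= -> ->]].
under eq_bigr do rewrite lawE.
rewrite sumEFin /mean big_mkcond/=; congr (_%:E).
by apply: eq_bigr => s _; case: (A s); rewrite ?mulr1 ?mulr0.
Qed.

Lemma mean_indic_expectation (A : pred S) :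
  expectation P (fun w => (A (Z w))%:R : R) = (mean (law P Z) (fun s => (A s)%:R))%:E.
Proof.
rewrite -prob_preimage -expectation_indic; last exact: (measurable_finpre A).
congr expectation; apply/funext => w; rewrite indicE.
by rewrite mem_setE.
Qed.

Lemma sum_law : \sum_s law P Z s = 1.
Proof.
apply: EFin_inj; have := prob_preimage xpredT; rewrite /mean.
rewrite (_ : [set w | _] = setT); last by apply/seteqP; split.
rewrite probability_setT => ->; congr EFin.
by apply: eq_bigr => s _; rewrite mulr1.
Qed.

Lemma mean_ge0_le1 f : (forall s, 0 <= f s <= 1) -> 0 <= mean (law P Z) f <= 1.
Proof.
move=> f01; rewrite sumr_ge0/= => [|s _]; last first.
  by rewrite mulr_ge0 ?law_ge0//; case/andP: (f01 s).
rewrite -sum_law ler_sum// => s _; rewrite -[leRHS]mulr1 ler_wpM2l ?law_ge0//.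
by case/andP: (f01 s).
Qed.

End Law.

Lemma mean_cst (R : realType) (S : finType) d (T : measurableType d)
    (P : probability T R) (Z : T -> S) (c : R) :
  (forall s, measurable [set w | Z w = s]) -> mean (law P Z) (fun=> c) = c.
Proof. by move=> mZ; rewrite /mean -mulr_suml sum_law// mul1r. Qed.

(** Outside the exceptional event g(Z) is within delta of v, and on this event
    the error is at most 1. *)
Lemma mean_dist_prob (R : realType) (S : finType) d (T : measurableType d)
    (P : probability T R) (Z : T -> S) (g : S -> R) (v delta : R) :
  (forall s, measurable [set w | Z w = s]) ->
  (forall s, 0 <= g s <= 1) -> 0 <= v <= 1 -> 0 <= delta ->
  `|mean (law P Z) g - v| <= delta + fine (P [set w | delta < `|g (Z w) - v|]).
Proof.
move=> mZ g01 v01 delta0.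
rewrite (prob_preimage P mZ (fun s => delta < `|g s - v|))/=.
rewrite -[v in leLHS](mean_cst P v mZ) -[X in _ <= X + _](mean_cst P delta mZ).
rewrite /mean -sumrB -big_split/= (le_trans (ler_norm_sum _ _ _))// ler_sum// => s _.
rewrite -mulrBr -mulrDr normrM ger0_norm ?law_ge0// ler_wpM2l ?law_ge0//.
case: ltP => [_|gv]; last by rewrite addr0.
rewrite -[leLHS]add0r lerD//= ler_distl; have := g01 s; lra.
Qed.

Lemma mean_cvg_in_prob (R : realType) (d : nat -> measure_display)
    (T : forall n, measurableType (d n)) (P : forall n, probability (T n) R)
    (S : nat -> finType) (Z : forall n, T n -> S n) (g : forall n, S n -> R) (v : R) :
  (forall n s, measurable [set w | Z n w = s]) ->
  (forall n s, 0 <= g n s <= 1) -> 0 <= v <= 1 ->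
  cvg_in_prob P (fun n w => g n (Z n w)) v ->
  (fun n => `|mean (law (P n) (Z n)) (g n) - v|) @ \oo --> (0 : R).
Proof.
move=> mZ g01 v01 gv; apply/cvgrPdist_le => e e0.
have e2 : 0 < e / 2 by rewrite divr_gt0.
have /fine_cvgP[_ /cvgrPdist_le/(_ _ e2)] := gv _ e2.
apply: filterS => n; rewrite /= !sub0r !normrN normr_id => Pn.
rewrite (le_trans (mean_dist_prob _ (mZ n) (g01 n) v01 (ltW e2)))//.
by rewrite [leRHS](splitr e) lerD2l (le_trans (ler_norm _) Pn).
Qed.

(** * Means along a Markov chain *)

Section MarkovMean.
Context {R : realType} {S : finType}.
Variable L : (S -> R) -> S -> R.
Hypothesis linL : linear L.

(** Mean of f at time t from the initial weights mu.  Being defined for every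
    real t, it has two-sided derivatives also at time 0, where the process
    itself only has a one-sided evolution. *)
Definition flow (mu : S -> R) (f : S -> R) (t : R) : R :=
  mean mu (semigroup L t f).

Lemma is_derive_flow mu f (t : R) :
  is_derive t 1 (flow mu f) (flow mu (L f) t).
Proof.
rewrite /flow /mean.
have -> : (fun t => \sum_s mu s * semigroup L t f s) =
    \sum_s (mu s *: (fun t => semigroup L t f s)).
  by apply/funext => u; rewrite fct_sumE.
elim/big_ind2 : _ => [|u g v h ? ?|s _].
- exact: is_derive_cst.
- exact: is_deriveD.
- have ? := is_derive_semigroup linL f s t; exact: is_derive_eq.
Qed.

Context d (T : measurableType d) (P : probability T R) (X : R -> T -> S).
Hypothesis markovX : is_markov_chain L P X.

(** Summing the Markov property for the times 0 and t over the value of X_0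
    expresses the law of X_t through the semigroup. *)
Lemma markov_mean f t : 0 <= t -> mean (law P (X t)) f = flow (law P (X 0)) f t.
Proof.
move=> t0; case: markovX => mX PX.
have lawt z : law P (X t) z =
    \sum_s law P (X 0) s * transition_prob L t s z.
  apply: EFin_inj; rewrite -sumEFin -lawE; last by move=> s; exact: mX.
  rewrite (_ : [set w | X t w = z] =
      \bigcup_(s in [set` xpredT]) ([set w | X 0 w = s] `&` [set w | X t w = z])); last first.
    by apply/seteqP; split => w /= => [?|[s _ []//]]; exists (X 0 w).
  rewrite measure_finType_bigcup; last 2 first.
  - by move=> s; apply: measurableI; exact: mX.
  - by move=> s s' _ _ [w [/= [-> _] [-> _]]].
  apply: eq_bigr => s _.
  have := PX (fun i => if i is 0%N then 0 else t) (fun i => if i is 0%N then s else z) 0%N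
     (lexx _).
  rewrite /= subr0 => /(_ _)/wrap[].
    by case=> [|i] [|j].
  rewrite !bigcap_mkord !big_ord_recl !big_ord0 !setIT/= => ->.
  by rewrite lawE// => ?; exact: mX.
rewrite /flow /mean; under eq_bigr do rewrite lawt mulr_suml.
rewrite exchange_big/=; apply: eq_bigr => s _.
rewrite (semigroup_expand linL) mulr_sumr; apply: eq_bigr => z _.
by rewrite -mulrA [X in _ * X]mulrC.
Qed.

End MarkovMean.

Section FlowHeat.
Context {R : realType} {S : finType}.
Variable L : (S -> R) -> S -> R.
Hypothesis linL : linear L.

Lemma flow_linear mu a b f g t :
  flow L mu (fun s => a * f s + b * g s) t = a * flow L mu f t + b * flow L mu g t.
Proof.
rewrite /flow /mean !mulr_sumr -big_split/=; apply: eq_bigr => s _.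
rewrite mulrCA [b * _]mulrCA -mulrDr; congr (_ * _).
rewrite !(semigroup_expand linL) !mulr_sumr -big_split/=.
by apply: eq_bigr => z _; ring.
Qed.

(** Closure of the hierarchy: L maps the observables f_k into their own span, so
    their means satisfy a linear system without correlation terms. *)
Lemma flow_heat N (f : nat -> S -> R) mu :
  (forall k, (k < N)%N ->
    L (f k.+1) = (fun s => 2^-1 * (f k s + f k.+2 s) - f k.+1 s)) ->
  heat_flow N (fun k => flow L mu (f k)).
Proof.
move=> Lf k kN t.
have := is_derive_flow linL mu (f k.+1) t; rewrite Lf//.
rewrite (_ : (fun s => _) =
    (fun s => 2^-1 * f k s + 1 * (2^-1 * f k.+2 s + -1 * f k.+1 s))).
  by rewrite !flow_linear mul1r mulN1r addrA -mulrDr.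
by apply/funext => s; ring.
Qed.

Lemma flow_exchange (f g : S -> R) c mu (t : R) :
  L f = (fun s => c * (g s - f s)) ->
  is_derive t 1 (flow L mu f) (c * (flow L mu g t - flow L mu f t)).
Proof.
move=> Lf; have := is_derive_flow linL mu f t; rewrite Lf.
rewrite (_ : (fun s => _) = (fun s => c * g s + (- c) * f s)).
  by rewrite flow_linear mulNr -mulrBr.
by apply/funext => s; ring.
Qed.

End FlowHeat.

(** * The generators on occupation variables and reservoir densities *)

Section Generators.
Context {R : realType} (n : nat).

(** The ghost sites 0 and N + 1 = n + 2 turn the boundary rates into the missing
    neighbours, so that one three-point formula holds at all sites. *)
Definition padded (l r : R) (eta : config n) (k : nat) : R :=
  if k is j.+1 then (if (j <= n)%N then (eta (inord j))%:R else r) else l.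

Lemma linear_ssep_generator (l r : R) : linear (@ssep_generator R n l r).
Proof.
move=> a f g; apply/funext => eta; rewrite !fctE /ssep_generator.
rewrite (_ : \sum_(x < n) _ =
    a * (\sum_(x < n) (f (exchange (inord x) (inord x.+1) eta) - f eta)) +
    \sum_(x < n) (g (exchange (inord x) (inord x.+1) eta) - g eta)).
  by rewrite /GRing.scale/=; ring.
rewrite mulr_sumr -big_split; apply: eq_bigr => x _.
by rewrite /GRing.scale/=; ring.
Qed.

(** Only the two bonds at a site change its occupation.  With k = x - 1 for the
    site x, the bond to the right exists when k < n and the bond to the left
    when 0 < k. *)
Lemma sum_bonds (l r : R) (eta : config n) k : (k <= n)%N ->
  \sum_(x < n) (padded l r (exchange (inord x) (inord x.+1) eta) k.+1
                - padded l r eta k.+1) =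
  (k < n)%:R * (padded l r eta k.+2 - padded l r eta k.+1) +
  (0 < k)%:R * (padded l r eta k - padded l r eta k.+1).
Proof.
move=> kn; pose e i : R := (eta (inord i))%:R.
have termE (x : 'I_n) : padded l r (exchange (inord x) (inord x.+1) eta) k.+1
      - padded l r eta k.+1 =
    (x == k :> nat)%:R * (e k.+1 - e k) + (x.+1 == k)%:R * (e k.-1 - e k).
  (* The values e n.+1 and e k.-1 at k = 0 are junk with coefficient 0. *)
  have xn := ltn_ord x.
  have inordE i j : (i <= n)%N -> (j <= n)%N ->
      (inord i == inord j :> 'I_n.+1) = (i == j).
    by move=> ? ?; rewrite -val_eqE/= !inordK.
  rewrite /padded kn /exchange ffunE -/(e k).
  have [xk|xk] := eqVneq (x : nat) k.
    by rewrite xk tpermL gtn_eqF// mul1r mul0r addr0.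
  have [xk'|xk'] := eqVneq x.+1 k.
    by rewrite xk' tpermR -xk' mul1r mul0r add0r.
  rewrite tpermD ?inordE// 1?ltnW// 1?eq_sym//.
  by rewrite subrr !mul0r addr0.
rewrite (eq_bigr _ (fun x _ => termE x)) big_split/= -!mulr_suml.
have -> : \sum_(x < n) (x == k :> nat)%:R = (k < n)%:R :> R.
  have [kn'|nk] := ltnP k n.
    rewrite (bigD1 (Ordinal kn'))//= eqxx big1 ?addr0// => x.
    by rewrite -val_eqE/= => /negbTE ->.
  by rewrite big1// => x _; rewrite ltn_eqF// (leq_trans (ltn_ord x)).
have -> : \sum_(x < n) (x.+1 == k)%:R = (0 < k)%:R :> R.
  case: k kn {termE} => [|k] kn /=; first by rewrite big1.
  rewrite (bigD1 (Ordinal kn))//= eqxx big1 ?addr0// => x.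
  by rewrite eqSS -val_eqE/= => /negbTE ->.
congr (_ + _).
  by rewrite /padded/= kn; case: ifP => _; rewrite ?mul0r.
by case: k kn {termE} => [|k] kn; rewrite ?mul0r// /padded/= kn (ltnW kn).
Qed.

Lemma flip_rate (v : R) (eta : config n) (y x : 'I_n.+1) :
  creation_removal_rate v (eta y) * ((flip y eta x)%:R - (eta x)%:R) =
  (x == y)%:R * (2^-1 * (v - (eta y)%:R)).
Proof.
rewrite /flip ffunE; have [->|_] := eqVneq x y; last by rewrite subrr mulr0 mul0r.
by rewrite /creation_removal_rate; case: (eta y) => /=; ring.
Qed.

(** Creation and removal act in the mean as an exchange at rate 1/2 with a ghost
    site, which replaces the missing bond of a boundary site.  A channel with a
    single site is exchanged with both ghosts. *)
Lemma ssep_generator_occupation (l r : R) (eta : config n) k : (k <= n)%N ->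
  ssep_generator l r (fun eta => (eta (inord k))%:R) eta =
  2^-1 * (padded l r eta k + padded l r eta k.+2) - padded l r eta k.+1.
Proof.
move=> kn; rewrite /ssep_generator !flip_rate.
have := sum_bonds l r eta kn; rewrite {1 2}/padded kn => ->.
have -> : (inord k == ord0 :> 'I_n.+1)%:R * (2^-1 * (l - (eta ord0)%:R)) =
    (1 - (0 < k)%:R) * (2^-1 * (padded l r eta k - padded l r eta k.+1)) :> R.
  case: k kn => [|k] kn; last by rewrite -val_eqE/= inordK// subrr !mul0r.
  rewrite (_ : inord 0 = ord0); last by apply: val_inj; rewrite /= inordK.
  by rewrite eqxx subr0 /padded/= (_ : inord 0 = ord0)//; apply: val_inj; rewrite /= inordK.
have -> : (inord k == ord_max :> 'I_n.+1)%:R * (2^-1 * (r - (eta ord_max)%:R)) =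
    (1 - (k < n)%:R) * (2^-1 * (padded l r eta k.+2 - padded l r eta k.+1)) :> R.
  rewrite -val_eqE/= inordK//; have [kn'|nk] := ltnP k n.
    by rewrite ltn_eqF// subrr !mul0r.
  have -> : k = n by apply/eqP; rewrite eqn_leq kn.
  rewrite eqxx subr0 /padded/= leqnn (_ : inord n = ord_max)//.
  by apply: val_inj; rewrite /= inordK.
by field.
Qed.

End Generators.

Section ChannelReservoirGenerator.
Context {R : realType} (n M : nat).
Hypothesis M0 : (0 < M)%N.
Local Notation state := (cr_state n M).

Definition fill (m : 'I_M.+1) : R := m%:R / M%:R.

Definition level (k : nat) (w : state) : R :=
  padded (fill (n_minus w)) (fill (n_plus w)) (occ w) k.

Lemma exchange_rateE b (m : 'I_M.+1) :
  exchange_rate b m = creation_removal_rate (fill m) b :> R.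
Proof. by case: b; rewrite /exchange_rate /creation_removal_rate /fill /=; ring. Qed.

Lemma linear_cr_generator : linear (@cr_generator R n M).
Proof.
move=> a f g; apply/funext => w; rewrite !fctE /cr_generator.
rewrite (_ : \sum_(x < n) _ = a * (\sum_(x < n) (f (move_bond x w) - f w)) +
    \sum_(x < n) (g (move_bond x w) - g w)).
  by rewrite /GRing.scale/=; ring.
rewrite mulr_sumr -big_split; apply: eq_bigr => x _.
by rewrite /GRing.scale/=; ring.
Qed.

(** On functions of the channel alone the reservoirs act through their present
    densities, as fixed reservoirs would. *)
Lemma cr_generator_occ (g : config n -> R) (w : state) :
  cr_generator (fun w => g (occ w)) w =
  ssep_generator (fill (n_minus w)) (fill (n_plus w)) g (occ w).
Proof.
rewrite /cr_generator /ssep_generator /c_right /c_left !exchange_rateE -!addrA.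
by congr (_ + _); rewrite addrC.
Qed.

Lemma cr_generator_level k : (k < n.+1)%N ->
  cr_generator (level k.+1) =
  (fun w => 2^-1 * (level k w + level k.+2 w) - level k.+1 w).
Proof.
rewrite ltnS => kn; apply/funext => w.
rewrite -ssep_generator_occupation// -cr_generator_occ; congr cr_generator.
by apply/funext => w'; rewrite /level/padded kn.
Qed.

(** The rate is linear in the density, and the jump is +1/M or -1/M: the
    products of the occupation b with the density cancel.  At m = M with b
    true, and at m = 0 with b false, the rate vanishes. *)
Lemma fill_update b (m : 'I_M.+1) :
  exchange_rate b m * (fill (reservoir_update b m) - fill m) =
  (2 * M%:R)^-1 * (b%:R - fill m).
Proof.
have M0' : M%:R != 0 :> R by rewrite pnatr_eq0 -lt0n.
rewrite exchange_rateE /creation_removal_rate /fill /reservoir_update.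
case: b => /=.
  have [mM|] := ltnP m M; first by rewrite inordK// -natr1; field.
  rewrite leq_eqVlt ltnNge -ltnS ltn_ord orbF => /eqP <-.
  by rewrite divff// subrr mulr0 mul0r mulr0.
have [->|m0] := posnP m; first by rewrite mul0r subrr !mulr0 mul0r.
rewrite inordK; last by rewrite prednK// ltnW.
have -> : (m.-1%:R : R) = m%:R - 1 by rewrite -subn1 natrB.
by field.
Qed.

Lemma level_last w : level n.+2 w = fill (n_plus w).
Proof. by rewrite /level/= ltnn. Qed.

Lemma level_site (x : 'I_n.+1) (w : state) : level x.+1 w = (occ w x)%:R.
Proof. by rewrite /level/= -ltnS ltn_ord inord_val. Qed.

Lemma cr_generator_n_plus : cr_generator (level n.+2) =
  (fun w => (2 * M%:R)^-1 * (level n.+1 w - level n.+2 w)).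
Proof.
rewrite (_ : level n.+2 = fun w => fill (n_plus w)); last first.
  by apply/funext => w; rewrite level_last.
apply/funext => w; rewrite /cr_generator big1 => [|x _]; last exact: subrr.
by rewrite subrr !mulr0 add0r addr0 /c_right fill_update -(level_site ord_max).
Qed.

Lemma cr_generator_n_minus : cr_generator (level 0) =
  (fun w => (2 * M%:R)^-1 * (level 1 w - level 0 w)).
Proof.
apply/funext => w; rewrite /cr_generator big1 => [|x _]; last exact: subrr.
by rewrite /level/= subrr !mulr0 !add0r /c_left fill_update -(level_site ord0).
Qed.

Lemma fill_ge0_le1 (m : 'I_M.+1) : 0 <= fill m <= 1.
Proof.
rewrite /fill divr_ge0//= ler_pdivrMr ?ltr0n// mul1r ler_nat.
by rewrite -ltnS ltn_ord.
Qed.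

End ChannelReservoirGenerator.

Lemma padded_ge0_le1 (R : realType) n (l r : R) (eta : config n) k :
  0 <= l <= 1 -> 0 <= r <= 1 -> 0 <= padded l r eta k <= 1.
Proof.
move=> hl hr; case: k => [|k] //=; case: ifP => // _.
by case: (eta _); rewrite ?lexx ler01.
Qed.

(** * Comparison of the two processes for a fixed number of sites *)

Section FixedSize.
Context {R : realType} (n M : nat).
Hypothesis M0 : (0 < M)%N.
Context d (Om : measurableType d) (P : probability Om R) (X : R -> Om -> cr_state n M).
Hypothesis markovX : is_markov_chain (@cr_generator R n M) P X.
Context d' (Om' : measurableType d') (Q : probability Om' R) (Y : R -> Om' -> config n).
Variables (vminus vplus : R).
Hypothesis hvminus : 0 <= vminus <= 1.
Hypothesis hvplus : 0 <= vplus <= 1.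
Hypothesis markovY : is_markov_chain (@ssep_generator R n vminus vplus) Q Y.
Hypothesis same_start : forall x,
  mean_occ P (fun w => occ (X 0 w)) x = mean_occ Q (Y 0) x.

Let p k t := flow (@cr_generator R n M) (law P (X 0)) (level k) t.
Let q k t := flow (@ssep_generator R n vminus vplus) (law Q (Y 0))
  (padded vminus vplus ^~ k) t.

Let pE k (t : R) : 0 <= t -> p k t = mean (law P (X t)) (level k).
Proof. by move=> t0; rewrite /p -markov_mean//; exact: linear_cr_generator. Qed.

Let qE k (t : R) : 0 <= t -> q k t = mean (law Q (Y t)) (padded vminus vplus ^~ k).
Proof. by move=> t0; rewrite /q -markov_mean//; exact: linear_ssep_generator. Qed.

Let mX (t : R) s : 0 <= t -> measurable [set w | X t w = s].
Proof. by case: markovX => + _; exact. Qed.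

Let mY (t : R) s : 0 <= t -> measurable [set w | Y t w = s].
Proof. by case: markovY => + _; exact. Qed.

Lemma mean_occ_cr (x : 'I_n.+1) (t : R) : 0 <= t ->
  mean_occ P (fun w => occ (X t w)) x = (mean (law P (X t)) (level x.+1))%:E.
Proof.
move=> t0; rewrite /mean_occ.
rewrite (mean_indic_expectation P (fun s => @mX t s t0) (fun s => occ s x)).
by congr (mean _ _)%:E; apply/funext => w; rewrite level_site.
Qed.

Lemma mean_occ_ssep (x : 'I_n.+1) (t : R) : 0 <= t ->
  mean_occ Q (Y t) x = (mean (law Q (Y t)) (padded vminus vplus ^~ x.+1))%:E.
Proof.
move=> t0; rewrite /mean_occ.
rewrite (mean_indic_expectation Q (fun s => @mY t s t0) (fun s : config n => s x)).
by congr (mean _ _)%:E; apply/funext => eta; rewrite /= -ltnS ltn_ord inord_val.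
Qed.

Let p_flow : reservoir_flow n.+1 M%:R p.
Proof.
split=> [|t|t].
- by apply: flow_heat => [|k]; [exact: linear_cr_generator|exact: cr_generator_level].
- by apply: flow_exchange; [exact: linear_cr_generator|exact: cr_generator_n_plus].
- by apply: flow_exchange; [exact: linear_cr_generator|exact: cr_generator_n_minus].
Qed.

Let q_flow : heat_flow n.+1 q.
Proof.
apply: flow_heat => [|k]; first exact: linear_ssep_generator.
rewrite ltnS => kn; apply/funext => eta; rewrite -ssep_generator_occupation//.
by congr ssep_generator; apply/funext => z; rewrite /padded kn.
Qed.

Let p01 k (t : R) : 0 <= t -> 0 <= p k t <= 1.
Proof.
move=> t0; rewrite pE//; apply: mean_ge0_le1 => s; first exact: mX.
by apply: padded_ge0_le1; exact: fill_ge0_le1.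
Qed.

Let q01 k (t : R) : 0 <= t -> 0 <= q k t <= 1.
Proof.
by move=> t0; rewrite qE//; apply: mean_ge0_le1 => s; [exact: mY|exact: padded_ge0_le1].
Qed.

Definition reservoir_error : R :=
  `|mean (law P (X 0)) (fun w => fill (n_minus w)) - vminus| +
  `|mean (law P (X 0)) (fun w => fill (n_plus w)) - vplus|.

(** The maximum principle for the difference of the profiles, whose values at
    the ghost sites are at most the initial error of the reservoirs plus their
    drift. *)
Lemma mean_occ_distance (S : R) (x : 'I_n.+1) (t : R) : 0 <= t <= S ->
  (`| mean_occ P (fun w => occ (X t w)) x - mean_occ Q (Y t) x | <=
   ((n.+1%:R + S / (2 * n.+2%:R)) / M%:R + reservoir_error)%:E)%E.
Proof.
move=> tS; have /andP[t0 t_S] := tS; have S0 := le_trans t0 t_S.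
rewrite mean_occ_cr// mean_occ_ssep// -EFinB -pE// -qE// lee_fin.
have M0' : 0 < M%:R :> R by rewrite ltr0n.
(* For u >= 0 the flow is an expectation, hence fixes constants. *)
have q0 (u : R) : 0 <= u -> q 0 u = vminus.
  by move=> u0; rewrite qE//= mean_cst// => s; exact: mY.
have qN (u : R) : 0 <= u -> q n.+2 u = vplus.
  move=> u0; rewrite qE//= -[RHS](@mean_cst _ _ _ _ Q (Y u)) => [|s]; last exact: mY.
  by congr mean; apply/funext => eta; rewrite /= ltnn.
have drift (u : R) k : 0 <= u <= S -> k = 0%N \/ k = n.+2 ->
    `|p k u - p k 0| <= (n.+1%:R + S / (2 * n.+2%:R)) / M%:R.
  move=> /andP[u0 uS] hk.
  apply: (le_trans (reservoir_drift M0' u0 p_flow _ hk)).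
    by move=> j v _ /andP[v0 _]; exact: p01.
  by rewrite ler_wpM2r ?invr_ge0// lerD2l ler_wpM2r// invr_ge0 mulr_ge0.
have edge (a b c D e : R) : `|a - b| <= D -> `|b - c| <= e -> `|a - c| <= D + e.
  by move=> h1 h2; rewrite (le_trans (ler_distD b _ _))// lerD.
have [p_heat _ _] := p_flow.
have := @heat_maximum_norm _ _ (fun k => p k - q k) S
  ((n.+1%:R + S / (2 * n.+2%:R)) / M%:R + reservoir_error) 1 S0
  (heat_flowB p_heat q_flow).
apply => //.
- by move=> k u _ /andP[u0 _]; have := p01 k u0; have := q01 k u0; rewrite !fctE ler_distl; lra.
- move=> k; rewrite ltnS => kn; rewrite !fctE pE// qE//.
  have := same_start (inord k); rewrite mean_occ_cr// mean_occ_ssep//.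
  rewrite !inordK// => -[->]; rewrite subrr normr0.
  rewrite addr_ge0//; last by rewrite addr_ge0.
  by rewrite divr_ge0// addr_ge0// divr_ge0// mulr_ge0.
- move=> u /[dup] uS /andP[u0 _]; rewrite !fctE q0// qN//; split.
  + apply: (edge _ (p 0%N 0)); first by apply: drift; [|left].
    by rewrite pE// /reservoir_error lerDl.
  + apply: (edge _ (p n.+2 0)); first by apply: drift; [|right].
    rewrite pE// /reservoir_error (_ : level n.+2 = fun w => fill (n_plus w)) ?lerDr//.
    by apply/funext => w; rewrite level_last.
Qed.

End FixedSize.

(** * Asymptotics of the bounds *)

Lemma powRN_cvg0 (R : realType) (a : R) : 0 < a ->
  (fun n : nat => n.+1%:R `^ (- a)) @ \oo --> (0 : R).
Proof.
move=> a0; apply/cvgrPdist_le => e e0.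
near=> n; rewrite sub0r normrN ger0_norm ?powR_ge0// powRN.
rewrite -[leRHS]invrK lef_pV2 ?posrE ?powR_gt0 ?invr_gt0//.
have -> : e^-1 = (e^-1 `^ a^-1) `^ a.
  by rewrite -powRrM mulVf ?gt_eqF// powRr1// invr_ge0 ltW.
apply: ge0_ler_powR; rewrite ?nnegrE ?powR_ge0//; first exact: ltW.
apply: (@le_trans _ _ n%:R); last by rewrite ler_nat.
by near: n; exact: nbhs_infty_ger.
Unshelve. all: by end_near. Qed.

(** Taking the integral part at most halves a number that is at least 1. *)
Lemma reservoir_size_ge (R : realType) (alpha : R) n : 0 <= alpha ->
  n.+1%:R `^ (1 + alpha) / 2 <= (reservoir_size alpha n)%:R.
Proof.
move=> alpha0; set y := _ `^ _.
have y1 : 1 <= y.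
  rewrite -(powRr0 (n.+1%:R : R)) ler_powR ?ler1n//; lra.
have : y < (reservoir_size alpha n).+1%:R by exact: truncnS_gt.
have : (1 : R) <= (reservoir_size alpha n)%:R by rewrite ler1n truncn_gt0.
by rewrite -natr1; lra.
Qed.

(** The left-hand side is the bound of [reservoir_drift] at the macroscopic time
    S, where beta stands for alpha'. *)
Lemma drift_bound (R : realType) (alpha beta S : R) n : 0 <= alpha -> 0 <= S ->
  (n.+1%:R + n.+1%:R `^ (2 + beta) * S / (2 * n.+2%:R)) / (reservoir_size alpha n)%:R
  <= 2 * n.+1%:R `^ (- alpha) + S * n.+1%:R `^ (- (alpha - beta)).
Proof.
move=> alpha0 S0; set M := (_ alpha n)%:R; set N : R := n.+1%:R.
have N0 : 0 < N by rewrite ltr0n.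
have M_ge : N `^ (1 + alpha) / 2 <= M by exact: reservoir_size_ge.
have y0 : 0 < N `^ (1 + alpha) / 2 by rewrite divr_gt0// powR_gt0.
have M0 : 0 < M := lt_le_trans y0 M_ge.
rewrite ler_pdivrMr//; apply: le_trans (ler_wpM2l _ M_ge); last first.
  by rewrite addr_ge0// mulr_ge0// powR_ge0.
have powD (u v : R) : N `^ (u + v) = N `^ u * N `^ v.
  by rewrite powRD// (gt_eqF N0) implybT.
have N1 : N `^ (- alpha) * N `^ (1 + alpha) = N.
  by rewrite -powD addrCA addNr addr0 powRr1// ltW.
have N2 : N `^ (- (alpha - beta)) * N `^ (1 + alpha) = N `^ (1 + beta).
  by rewrite -powD; congr (_ `^ _); ring.
rewrite [leRHS](_ : _ = N + S * N `^ (1 + beta) / 2); last first.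
  by rewrite -[X in _ = X + _]N1 -N2; field.
rewrite lerD2l (_ : 2 + beta = 1 + (1 + beta)); last by ring.
rewrite powD (powRr1 (ltW N0)) ler_pdivrMr ?mulr_gt0//.
rewrite [leRHS](_ : _ = (S * N `^ (1 + beta)) * n.+2%:R); last by field.
rewrite -mulrA mulrC [X in X * _]mulrC ler_wpM2l ?mulr_ge0 ?powR_ge0//.
by rewrite ler_nat.
Qed.

Theorem theorem3p1 (R : realType) (alpha : R) (halpha : 0 < alpha)
  (u0 : R -> R) (hu0 : forall x : R, 0 < x <= 1 -> 0 <= u0 x <= 1)
  (cu0 : {in `]0, 1[, continuous u0})
  (vminus vplus : R) (hvminus : 0 <= vminus <= 1) (hvplus : 0 <= vplus <= 1)
  (* the channel-reservoir processes, one for each N = n.+1 *)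
  (d : nat -> measure_display) (Om : forall n : nat, measurableType (d n))
  (P : forall n : nat, probability (Om n) R)
  (X : forall n : nat, R -> Om n -> cr_state n (reservoir_size alpha n))
  (hX : forall n : nat, is_markov_chain (@cr_generator R _ _) (P n) (X n))
  (hminus : cvg_in_prob P
     (fun n w => (n_minus (X n 0 w))%:R / (reservoir_size alpha n)%:R) vminus)
  (hplus : cvg_in_prob P
     (fun n w => (n_plus (X n 0 w))%:R / (reservoir_size alpha n)%:R) vplus)
  (hX0 : forall (n : nat) (x : 'I_n.+1),
     mean_occ (P n) (fun w => occ (X n 0 w)) x = (u0 (x.+1%:R / n.+1%:R))%:E)
  (* the exclusion processes with fixed reservoirs *)
  (d' : nat -> measure_display) (Om' : forall n : nat, measurableType (d' n))
  (Q : forall n : nat, probability (Om' n) R)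
  (Y : forall n : nat, R -> Om' n -> config n)
  (hY : forall n : nat,
     is_markov_chain (@ssep_generator R n vminus vplus) (Q n) (Y n))
  (hY0 : forall (n : nat) (x : 'I_n.+1),
     mean_occ (Q n) (Y n 0) x = (u0 (x.+1%:R / n.+1%:R))%:E)
  (alpha' : R) (halpha' : 0 <= alpha' < alpha) (T : R) (hT : 0 < T) :
  (fun n : nat =>
     ereal_sup [set ereal_sup
       [set (let s := (n.+1%:R `^ (2 + alpha') * t)%R in
             `| mean_occ (P n) (fun w => occ (X n s w)) x
                - mean_occ (Q n) (Y n s) x |)%E
         | t in [set t : R | 0 <= t <= T]]
       | x in [set: 'I_n.+1]])
  @ \oo --> 0%E.
Proof.
have M0 n : (0 < reservoir_size alpha n)%N.
  rewrite -(ltr0n R); apply: lt_le_trans (reservoir_size_ge n (ltW halpha)).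
  by rewrite divr_gt0// powR_gt0.
have mX0 n s : measurable [set w | X n 0 w = s] by case: (hX n) => + _; apply.
pose bound n := 2 * n.+1%:R `^ (- alpha) + T * n.+1%:R `^ (- (alpha - alpha')) +
  reservoir_error (P n) (X n) vminus vplus.
have bound0 : bound @ \oo --> 0.
  have -> : 0 = 2 * 0 + T * 0 + (0 + 0) :> R by rewrite !mulr0 !addr0.
  apply: cvgD.
    apply: cvgD; apply: cvgMl_tmp; apply: powRN_cvg0 => //.
    by case/andP: halpha' => _; rewrite subr_gt0.
  by apply: cvgD; apply: mean_cvg_in_prob => // n s; exact: fill_ge0_le1.
have supE n (x : 'I_n.+1) (t : R) : 0 <= t <= T ->
    (`| mean_occ (P n) (fun w => occ (X n (n.+1%:R `^ (2 + alpha') * t)%R w)) x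
        - mean_occ (Q n) (Y n (n.+1%:R `^ (2 + alpha') * t)%R) x | <= (bound n)%:E)%E.
  move=> /andP[t0 tT].
  have same_start y : mean_occ (P n) (fun w => occ (X n 0 w)) y = mean_occ (Q n) (Y n 0) y.
    by rewrite hX0 hY0.
  apply: le_trans (mean_occ_distance (M0 n) (hX n) hvminus hvplus (hY n) same_start
    (S := n.+1%:R `^ (2 + alpha') * T) x _) _.
    by rewrite mulr_ge0 ?powR_ge0//= ler_wpM2l ?powR_ge0.
  by rewrite lee_fin lerD2r drift_bound// ltW.
apply: (@squeeze_cvge _ _ _ _ (cst 0%E) _ (fun n => (bound n)%:E)).
- apply: nearW => n; apply/andP; split.
    (* Suprema over empty sets would be -oo; site 1 and time 0 are witnesses. *)
    apply: le_ereal_sup_tmp; eexists; first by exists ord0.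
    apply: le_ereal_sup_tmp; eexists; first by exists 0 => //=; rewrite lexx ltW.
    exact: abse_ge0.
  apply: ge_ereal_sup => _ [x _ <-]; apply: ge_ereal_sup => _ [t /= tT <-].
  exact: supE.
- exact: cvg_cst.
- by apply: cvg_EFin; [exact: nearW|exact: bound0].
Qed.
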